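(* For every ordinal $\alpha<\omega_1$ there is a weakly null sequence $(x^\alpha_n)$ in $C(\omega^{\omega^\alpha})$ with $$\mathcal O^{\omega^\alpha}\left(1-\epsilon,(x^\alpha_n),\omega^{\omega^\alpha}\right)\neq\emptyset$$ for every $\epsilon>0$ (with $1-\epsilon>0$, so that the oscillation set is defined). Moreover, for each $\alpha$, $(x_n^\alpha)$ is a sequence of indicator functions and is a $1$-suppression unconditional basic sequence.
   Context: For an ordinal $\alpha$, ''$\alpha$'' used as a topological space denotes the space of ordinals less than or equal to $\alpha$ with the order topology, and $C(\alpha)$ denotes the continuous real functions on it with the supremum norm. A basic sequence $(x_n)$ is $1$-suppression unconditional if $\|\sum_{n\in G}a_nx_n\|\le\|\sum_n a_nx_n\|$ for all finitely supported scalar sequences $(a_n)$ and all $G\subset\mathbb N$. **Oscillation sets.** For a Polish space $K$, a pointwise convergent sequence $(f_n)$ of continuous real-valued functions on $K$ and $\delta>0$, put $A^+_{n,m}=\{k\in K: f_n(k)-f_m(k)>\delta\}$ and $A^-_{n,m}=\{k\in K: f_n(k)-f_m(k)<-\delta\}$. Let $\mathcal O^0(\delta,(f_n),K)=K$. Let $\mathcal O^{\alpha+1}(\delta,(f_n),K)$ be the set of $k\in\mathcal O^{\alpha}(\delta,(f_n),K)$ such that for every neighborhood $\mathcal N$ of $k$ there is $N\in\mathbb N$ such that for all $n\ge N$ there is $M\in\mathbb N$ with $\bigcap_{m\ge M}A^+_{n,m}\cap\mathcal O^\alpha(\delta,(f_n),K)\cap\mathcal N\ne\emptyset$ or $\bigcap_{m\ge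 M}A^-_{n,m}\cap\mathcal O^\alpha(\delta,(f_n),K)\cap\mathcal N\ne\emptyset$. For a limit ordinal $\beta$, $\mathcal O^\beta(\delta,(f_n),K)=\bigcap_{\alpha<\beta}\mathcal O^\alpha(\delta,(f_n),K)$. *)

(* Defs.v *)
From HB Require Import structures.
From mathcomp Require Import all_boot all_order all_algebra.
From mathcomp Require Import all_classical all_reals all_analysis.
From mathcomp Require wochoice.

Set Implicit Arguments.
Unset Strict Implicit.
Unset Printing Implicit Defensive.

Import Order.TTheory GRing.Theory Num.Theory.
Import numFieldNormedType.Exports.

Local Open Scope classical_set_scope.
Local Open Scope ring_scope.

Definition wo_le : rel (set nat) :=
  sval (wochoice.well_ordering_principle (set nat)).

Lemma wo_leP : wochoice.well_order wo_le.
Proof. exact: (svalP (wochoice.well_ordering_principle (set nat))). Qed.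

Lemma wo_least (A : set (set nat)) : A !=set0 ->
  exists z, A z /\ forall x, A x -> wo_le z x.
Proof.
case=> x Ax; have [|z [[zA zmin] _]] := wo_leP (A := mem A).
  by exists x; apply/mem_set.
exists z; split; first exact/set_mem.
by move=> y Ay; apply: zmin; apply/mem_set.
Qed.

Lemma wo_le_refl : reflexive wo_le.
Proof. by move=> x; have [|z [-> ]] := @wo_least [set x]; [exists x|exact]. Qed.

Lemma wo_le_total : total wo_le.
Proof.
move=> x y; have [|z [[]-> zmin]] := @wo_least [set x; y]; first by exists x; left.
- by rewrite zmin//; right.
- by rewrite [wo_le y x]zmin ?orbT//; left.
Qed.

Lemma wo_le_anti : antisymmetric wo_le.
Proof.
move=> x y /andP[xy yx].
have [|z [_ zuniq]] := wo_leP (A := pred2 x y); first by exists x; rewrite inE eqxx.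
rewrite -(zuniq x) ?(zuniq y)//; split; rewrite ?inE ?eqxx ?orbT// => t.
  by rewrite inE => /orP[] /eqP-> //; exact: wo_le_refl.
by rewrite inE => /orP[] /eqP-> //; exact: wo_le_refl.
Qed.

Lemma wo_le_trans : transitive wo_le.
Proof.
move=> y x z xy yz.
have [|t [tA tmin]] := @wo_least [set x; y; z]; first by exists x; left; left.
case: tA tmin => [[]|] -> tmin; first by apply: tmin; right.
- have yx : wo_le y x by apply: tmin; left; left.
  by rewrite (@wo_le_anti x y)// xy.
- have zy : wo_le z y by apply: tmin; left; right.
  by rewrite -(@wo_le_anti y z)// yz.
Qed.

(* The elements with countably many predecessors, in a well-order of an
   uncountable set, form a well-ordered set of order type omega_1: it is
   uncountable (omega1_uncountable) and its proper initial segments are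
   countable (omega1_countable_segment). *)
Definition omega1 : Type :=
  {x : set nat | `[< countable [set y | wo_le y x] >]}.

HB.instance Definition _ := Choice.on omega1.

Fact omega1_display : Order.disp_t. Proof. exact: Order.Disp tt tt. Qed.

Definition omega1_le : rel omega1 := fun a b => wo_le (val a) (val b).

Fact omega1_le_refl : reflexive omega1_le.
Proof. by move=> a; exact: wo_le_refl. Qed.

Fact omega1_le_anti : antisymmetric omega1_le.
Proof. by move=> a b /wo_le_anti/val_inj. Qed.

Fact omega1_le_trans : transitive omega1_le.
Proof. by move=> b a c; exact: wo_le_trans. Qed.

HB.instance Definition _ := Order.Le_isPOrder.Build omega1_display omega1
  omega1_le_refl omega1_le_anti omega1_le_trans.

Fact omega1_le_total : total (<=%O : rel omega1).
Proof. by move=> a b; exact: wo_le_total. Qed.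

HB.instance Definition _ :=
  Order.POrder_isTotal.Build omega1_display omega1 omega1_le_total.

Lemma omega1_least (A : set omega1) : A !=set0 ->
  exists a, A a /\ forall b, A b -> (a <= b)%O.
Proof.
case=> a Aa; have [|z [[b Ab <-] zmin]] := @wo_least (val @` A).
  by exists (val a); exists a.
by exists b; split=> // c Ac; apply: zmin; exists c.
Qed.

Lemma omega1_wf : well_founded (fun a b : omega1 => (a < b)%O).
Proof.
move=> a; apply: contrapT => na.
have [|b [nb bmin]] := @omega1_least [set b | ~ Acc (fun a b => (a < b)%O) b].
  by exists a.
apply: nb; constructor => c cb; apply: contrapT => /bmin.
by rewrite leNgt cb.
Qed.

Lemma omega1_countable_segment (a : omega1) : countable [set b | (b <= a)%O].
Proof.
have := valP a => /asboolP; apply: sub_countable.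
apply: (@card_le_trans _ _ _ (val @` [set b | (b <= a)%O])); last first.
  by apply: subset_card_le => _ [b ba <-].
by have /card_eqPle[] := inj_card_eq (A := [set b | (b <= a)%O])
  (in2W (val_inj : injective (val : omega1 -> set nat))).
Qed.

Lemma omega1_uncountable : ~ countable [set: omega1].
Proof.
move=> cT.
have cV : countable (val @` [set: omega1]).
  exact: sub_countable (card_image_le _ _) cT.
have [allT|/existsNP[x nx]] :=
    pselect (forall x, countable [set y | wo_le y x]).
  have cS : countable [set: set nat].
    apply: sub_countable cV; apply: subset_card_le => x _.
    by exists (exist _ x (asboolT (allT x))).
  have [f finj] := countable_injP _ cS.
  pose D := [set n | exists2 X : set nat, f X = n & ~ X n].
  have DfD : D (f D) <-> ~ D (f D).
    split=> [[X /finj]|nD]; last by exists D.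
    by rewrite !inE => /(_ I I) ->.
  by have [DD|nD] := pselect (D (f D)); [exact: (DfD.1 DD)|exact/nD/DfD].
have [|z [nz zmin]] := @wo_least [set x | ~ countable [set y | wo_le y x]].
  by exists x.
apply: nz; apply: (@sub_countable _ _ _ ((val @` [set: omega1]) `|` [set z])).
  apply: subset_card_le => y yz.
  have [->|yNz] := eqVneq y z; [by right|left].
  have cy : countable [set t | wo_le t y].
    apply: contrapT => /zmin zy; move/eqP: yNz; apply.
    by apply: wo_le_anti; rewrite yz.
  by exists (exist _ y (asboolT cy)).
by rewrite setUC -bigcup2E; apply: bigcup_countable => // -[|[|n]] _ /=.
Qed.

Lemma omega1_unbounded (A : set omega1) : countable A ->
  exists b, forall a, A a -> (a < b)%O.
Proof.
move=> cA; apply: contrapT => /forallNP nb; apply: omega1_uncountable.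
apply: (@sub_countable _ _ _ (\bigcup_(a in A) [set b | (b <= a)%O])).
  apply: subset_card_le => b _.
  have /existsNP[a /not_implyP[Aa /negP]] := nb b.
  by rewrite -leNgt => ba; exists a.
by apply: bigcup_countable => // a _; exact: omega1_countable_segment.
Qed.

Lemma omega1_inhabited : exists a : omega1, True.
Proof. by have [|b _] := @omega1_unbounded set0; [exact: countable0|exists b]. Qed.

HB.instance Definition _ := isPointed.Build omega1 (sval (cid omega1_inhabited)).

(* get returns a default value when A is empty. *)
Definition oleast (A : set omega1) : omega1 :=
  get [set a | A a /\ forall b, A b -> (a <= b)%O].

Definition ozero : omega1 := oleast setT.

Definition osucc (a : omega1) : omega1 := oleast [set b | (a < b)%O].

Definition osup (A : set omega1) : omega1 := oleast (ubound A).

Definition osucc_of (a b : omega1) : Prop :=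
  (b < a)%O /\ forall c, (c < a)%O -> (c <= b)%O.

Definition olimit (a : omega1) : Prop :=
  a <> ozero /\ forall b, ~ osucc_of a b.

Section transfinite_recursion.
Context {T : Type} (z : T) (s : T -> T) (l : set T -> T).

Let body (a : omega1) (rec : forall b : omega1, (b < a)%O -> T) : T :=
  match pselect (exists b, osucc_of a b) with
  | left h => s (rec (sval (cid h)) (svalP (cid h)).1)
  | right _ => if a == ozero then z else
      l [set t | exists b (h : (b < a)%O), t = rec b h]
  end.

(* f 0 = z, f (b + 1) = s (f b), and f a = l {f b | b < a} for a limit; see
   orec0, orecS and orec_limit. *)
Definition orec : omega1 -> T := Fix omega1_wf (fun=> T) body.

End transfinite_recursion.

Definition oadd (a : omega1) : omega1 -> omega1 := orec a osucc osup.

Definition omul (a : omega1) : omega1 -> omega1 :=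
  orec ozero (fun x => oadd x a) osup.

Definition oexp (a : omega1) : omega1 -> omega1 :=
  orec (osucc ozero) (fun x => omul x a) osup.

Definition oomega : omega1 := osup (range (fun n => iter n osucc ozero)).

Lemma oleastP (A : set omega1) : A !=set0 ->
  A (oleast A) /\ forall b, A b -> (oleast A <= b)%O.
Proof. by move=> /omega1_least/getPex. Qed.

Lemma ozero_le (a : omega1) : (ozero <= a)%O.
Proof. by have [|_] := @oleastP setT; [exists a|exact]. Qed.

Lemma osuccP (a : omega1) : osucc_of (osucc a) a.
Proof.
have [|asa sa] := @oleastP [set b | (a < b)%O].
  have [|b ab] := @omega1_unbounded [set a]; first exact: countable1.
  by exists b; exact: ab.
by split=> // c; rewrite ltNge => /negP csa; rewrite leNgt; apply/negP => /sa.
Qed.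

Lemma osucc_ofE (a b : omega1) : osucc_of a b <-> a = osucc b.
Proof.
split=> [[ba amin]|->]; last exact: osuccP.
have [bsb smin] := osuccP b; apply/le_anti/andP; split.
  by rewrite leNgt; apply/negP => /amin; rewrite leNgt bsb.
by rewrite leNgt; apply/negP => /smin; rewrite leNgt ba.
Qed.

Lemma osucc_inj : injective osucc.
Proof.
move=> a b ab; have [h1 h2] := osuccP a; have [h3 h4] := osuccP b.
by apply/le_anti; rewrite h4 -?ab// h2// ab.
Qed.

Lemma osupP (A : set omega1) : countable A ->
  ubound A (osup A) /\ forall b, ubound A b -> (osup A <= b)%O.
Proof.
move=> /omega1_unbounded[b Ab]; apply: oleastP; exists b => a /Ab; exact: ltW.
Qed.

Section transfinite_recursion_theory.
Context {T : Type} (z : T) (s : T -> T) (l : set T -> T).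

Let orecE (a : omega1) : orec z s l a =
  match pselect (exists b, osucc_of a b) with
  | left h => s (orec z s l (sval (cid h)))
  | right _ => if a == ozero then z else
      l [set t | exists b (_ : (b < a)%O), t = orec z s l b]
  end.
Proof.
rewrite /orec Fix_eq// => x f g fg.
have -> // : f = g.
by apply: functional_extensionality_dep => y;
  apply: functional_extensionality_dep => p; exact: fg.
Qed.

Lemma orec0 : orec z s l ozero = z.
Proof.
rewrite orecE eqxx; case: pselect => // h; have [b [+ _]] := h.
by rewrite ltNge ozero_le.
Qed.

Lemma orecS (a : omega1) : orec z s l (osucc a) = s (orec z s l a).
Proof.
rewrite orecE; case: pselect => [h|]; last first.
  by move=> /forallNP/(_ a); have := osuccP a.
by case: cid => b /= /osucc_ofE/osucc_inj ->.
Qed.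

Lemma orec_limit (a : omega1) : olimit a ->
  orec z s l a = l (orec z s l @` [set b | (b < a)%O]).
Proof.
move=> [/eqP/negPf a0 aS]; rewrite orecE a0; case: pselect => [h|_].
  by have [b /aS] := h.
congr l; apply/seteqP; split=> [t [b [ba ->]]|t [b ba <-]].
  by exists b.
by exists b, ba.
Qed.

End transfinite_recursion_theory.

HB.mixin Record isCompactSpace K & Topological K := {
  compact_setT : compact [set: K]
}.

#[short(type="compactType")]
HB.structure Definition CompactSpace := {K of Topological K & isCompactSpace K}.

Section continuous_functions.
Context (R : realType) (K : compactType).

Definition continuous_pred : {pred K -> R^o} :=
  fun f => `[< continuous f >].

Definition Cspace : Type := {f : K -> R^o | f \in continuous_pred}.

HB.instance Definition _ := SubChoice.on Cspace.

Definition Cspace_fun (f : Cspace) : K -> R := val f.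

Coercion Cspace_fun : Cspace >-> Funclass.

Fact continuous_submod_closed : submod_closed continuous_pred.
Proof.
split=> [|a f g]; rewrite /in_mem /= /continuous_pred.
  by apply/asboolP => k; exact: cvg_cst.
move=> /asboolP cf /asboolP cg; apply/asboolP => k.
by apply: cvgD; [apply: cvgZr; exact: cf|exact: cg].
Qed.

HB.instance Definition _ :=
  GRing.isSubmodClosed.Build R (K -> R^o) continuous_pred
    continuous_submod_closed.

HB.instance Definition _ := [SubChoice_isSubLmodule of Cspace by <:].

Definition supnorm (f : Cspace) : R := sup (range (fun k => `|f k|)).

Lemma Cspace_continuous (f : Cspace) : continuous (f : K -> R).
Proof. by have /asboolP := valP f. Qed.

Lemma supnorm_ge (f : Cspace) (k : K) : `|f k| <= supnorm f.
Proof.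
apply: ub_le_sup; last by exists k.
have cf : compact ((f : K -> R^o) @` setT).
  apply: continuous_compact compact_setT.
  by apply: continuous_subspaceT; exact: Cspace_continuous.
have [M [_ fM]] := compact_bounded cf.
exists (M + 1) => _ [x _ <-]; apply: fM; first by rewrite ltrDl.
by exists x.
Qed.

Lemma supnorm_le (f : Cspace) (M : R) :
  0 <= M -> (forall k, `|f k| <= M) -> supnorm f <= M.
Proof.
move=> M0 fM; have [[k _]|/forallNP nK] := pselect (exists k : K, True).
  by apply: ge_sup => [|_ [x _ <-]]; [exists `|f k|; exists k|exact: fM].
rewrite /supnorm; have -> : range (fun k => `|f k|) = set0; last by rewrite sup0.
by apply/seteqP; split=> // t [x _ _]; case: (nK x).
Qed.

Lemma supnorm_ge0 (f : Cspace) : 0 <= supnorm f.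
Proof.
have [[k _]|/forallNP nK] := pselect (exists k : K, True).
  exact: le_trans (normr_ge0 _) (supnorm_ge f k).
rewrite /supnorm; have -> : range (fun k => `|f k|) = set0; last by rewrite sup0.
by apply/seteqP; split=> // t [x _ _]; case: (nK x).
Qed.

Fact supnormD (f g : Cspace) : supnorm (f + g) <= supnorm f + supnorm g.
Proof.
apply: supnorm_le => [|k]; first by rewrite addr_ge0 ?supnorm_ge0.
by rewrite (le_trans (ler_normD _ _))// lerD ?supnorm_ge.
Qed.

Let supnormZ_le (a : R) (f : Cspace) : supnorm (a *: f) <= `|a| * supnorm f.
Proof.
apply: supnorm_le => [|k]; first by rewrite mulr_ge0 ?supnorm_ge0.
by rewrite [X in `|X|](_ : _ = a * f k)// normrM ler_wpM2l ?supnorm_ge.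
Qed.

Fact supnormZ (a : R) (f : Cspace) : supnorm (a *: f) = `|a| * supnorm f.
Proof.
apply/le_anti; rewrite supnormZ_le/=.
have [->|a0] := eqVneq a 0; first by rewrite normr0 mul0r supnorm_ge0.
rewrite -ler_pdivlMl ?normr_gt0// -normfV.
by rewrite (le_trans _ (supnormZ_le _ _))// scalerA mulVf// scale1r.
Qed.

Fact supnorm0_eq0 (f : Cspace) : supnorm f = 0 -> f = 0.
Proof.
move=> f0; apply: val_inj; apply/funext => k; apply/eqP.
by rewrite -normr_le0 -f0; exact: supnorm_ge.
Qed.

HB.instance Definition _ :=
  Lmodule_isNormed.Build R Cspace supnormD supnormZ supnorm0_eq0.

End continuous_functions.

Definition oseg (a : omega1) : Type := {b : omega1 | (b <= a)%O}.

HB.instance Definition _ a := SubChoice.on (oseg a).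
HB.instance Definition _ a :=
  [SubChoice_isSubOrder of oseg a by <: with omega1_display].

Definition ospace (a : omega1) : Type := order_topology (oseg a).

HB.instance Definition _ a :=
  OrderTopological.copy (ospace a) (order_topology (oseg a)).

Lemma ospace_compact (a : omega1) : compact [set: ospace a].
Proof.
move=> F FF _.
have topE : [set b : ospace a | (val b <= a)%O] = setT.
  by apply/seteqP; split=> // b _; exact: (valP b).
have [|m [Fm mmin]] :=
    @omega1_least [set c | F [set b : ospace a | (val b <= c)%O]].
  by exists a; rewrite /= topE; exact: filterT.
have ma : (m <= a)%O by apply: mmin; rewrite /= topE; exact: filterT.
exists (exist _ m ma : ospace a); split=> // A U FA.
rewrite itv_nbhsE => -[[l r] [oi mi] iU].
have FAm : F (A `&` [set b : ospace a | (val b <= m)%O]) by exact: filterI.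
have {mi} /andP[lm mr] : (l <= BLeft (exist _ m ma : ospace a))%O &&
  (BRight (exist _ m ma : ospace a) <= r)%O by rewrite -itv_boundlr.
have in_lr (b : ospace a) : (val b <= m)%O -> (l <= BLeft b)%O ->
    b \in Interval l r.
  move=> bm lb; rewrite itv_boundlr lb/=; apply: le_trans mr.
  by rewrite bnd_simp.
case: l oi lm in_lr iU => [bl l oi lm|[] oi lm]; last 2 first.
- move=> in_lr iU; have [b [Ab bm]] := filter_ex FAm.
  by exists b; split=> //; apply: iU; exact: in_lr.
- by [].
move=> in_lr iU; apply: contrapT => nAU.
have /mmin : F [set b : ospace a | (val b <= val l)%O].
  apply: filterS FAm => b [Ab bm]; rewrite /= leNgt; apply/negP => lb.
  apply: nAU; exists b; split=> //; apply: iU; apply: in_lr => //.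
  by case: bl {oi lm} => /=; rewrite bnd_simp// ltW.
move: lm; rewrite (itv_open_ends_lside oi) bnd_simp => lm.
by rewrite leNgt => /negP; apply; exact: lm.
Qed.

HB.instance Definition _ a := isCompactSpace.Build (ospace a) (@ospace_compact a).

Section sequences.
Context (R : realType) (V : normedModType R).
Implicit Types x : nat -> V.

Definition weakly_null x : Prop :=
  forall phi : {linear V -> R^o}, continuous phi ->
    phi (x n) @[n --> \oo] --> (0 : R^o).

Definition lin_span x : set V :=
  [set y | exists (a : nat -> R) (N : nat), y = \sum_(n < N) a n *: x n].

(* x is a Schauder basis of its closed linear span. *)
Definition basic_sequence x : Prop :=
  forall y, closure (lin_span x) y ->
    exists! a : nat -> R, series (fun n => a n *: x n) @ \oo --> y.

Definition suppression_unconditional1 x : Prop :=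
  forall (a : nat -> R) (G : set nat), finite_set [set n | a n != 0] ->
    `|\sum_(n \in G) a n *: x n| <= `|\sum_(n \in setT) a n *: x n|.

End sequences.

Section oscillation.
Context (R : realType) (K : topologicalType) (delta : R) (f : nat -> K -> R).

Definition osc_pos (n m : nat) : set K := [set k | f n k - f m k > delta].

Definition osc_neg (n m : nat) : set K := [set k | f n k - f m k < - delta].

Definition osc_step (O : set K) : set K :=
  [set k | O k /\ forall U, nbhs k U -> exists N, forall n, (N <= n)%N ->
    exists M,
      (\bigcap_(m >= M) osc_pos n m) `&` O `&` U !=set0 \/
      (\bigcap_(m >= M) osc_neg n m) `&` O `&` U !=set0].

Definition oscillation : omega1 -> set K :=
  orec setT osc_step (fun F => \bigcap_(O in F) O).

Lemma oscillation0 : oscillation ozero = setT.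
Proof. exact: orec0. Qed.

Lemma oscillationS (a : omega1) :
  oscillation (osucc a) = osc_step (oscillation a).
Proof. exact: orecS. Qed.

Lemma oscillation_limit (b : omega1) : olimit b ->
  oscillation b = \bigcap_(a in [set a | (a < b)%O]) oscillation a.
Proof. by move=> b_lim; rewrite /oscillation orec_limit// bigcap_image. Qed.

End oscillation.

(* Main.v *)
Require Import Defs.
From mathcomp Require Import all_boot all_order all_algebra.
From mathcomp Require Import all_classical all_reals all_analysis.

Set Implicit Arguments.
Unset Strict Implicit.
Unset Printing Implicit Defensive.

Import Order.TTheory GRing.Theory Num.Theory.
Import numFieldNormedType.Exports.
Local Open Scope classical_set_scope.
Local Open Scope ring_scope.

(** The sequence is x_n = 1_(A n) with A n = {k | n \in F k}, where F sends
each ordinal k <= w^b, b = w^alpha, to a finite set of integers. Once F is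
locally constant at every n (so that A n is clopen) and its values form a
hereditary family containing the singletons, everything but the oscillation
follows from these properties alone.

- Heredity gives, for each point k and each G, a point k' with
  F k' = F k `&` G, at which any combination of the x_n takes the value that
  its restriction to G takes at k. This is suppression unconditionality.
- A point k_n with F k_n = {n} reads off the n-th coefficient, and the
  identity y k' = sum_(n < N) y (k_n) x_n(k) for F k' = F k `&` [0, N) passes
  from the span to its closure; so the expansion of y in the closure has
  coefficients y (k_n), and its partial sums converge uniformly.
- Each k lies in finitely many A n, so (x_n) is pointwise null. It is weakly
  null by induction on the point k for the restrictions of x_n to [0, k]: if
  S is the supremum of phi over the unit ball of functions vanishing
  beyond some g < k, and h nearly attains it, then a function of norm at most
  one that lives between the support of h and k can be added to h or
  subtracted from it without leaving that ball, so phi is small on it (functional_initial).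

The family has to be large enough for the b-th oscillation set and small
enough to be carried by w^b. It is built by recursion on b: its members are
the empty set, the sets S `&` (n, oo) and the sets {n} `|` (S `&` (n, oo)) with
S in the family of an ordinal d_n < b, where each d < b is eventually at most
d_n (ranked_family). Correspondingly, below a point k of Cantor-Bendixson rank
at least b there are points c_0 < c_1 < ... such that c_(p+1) has rank at
least d_(p/2); the families of the d_n are placed on the intervals
(c_p, c_(p+1)], the even ones with n added, and the supremum of the c_p gets
the empty set (representation). Arbitrarily close to this supremum there are,
for all large n, points of the d_n-th oscillation set that belong to A n, so it
belongs to the b-th one (branch_rank, oscillation_branch_rank). Finally
w^b has Cantor-Bendixson rank b (cb_rank_oexp). *)

(** * Ordinal arithmetic *)

Lemma omega1_ind (P : omega1 -> Prop) :
  (forall b, (forall c, (c < b)%O -> P c) -> P b) -> forall b, P b.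
Proof. by move=> step b; elim/(well_founded_induction omega1_wf): b. Qed.

Lemma osucc_gt (b : omega1) : (b < osucc b)%O.
Proof. exact: (osuccP b).1. Qed.

Lemma ltoS (c b : omega1) : (c < osucc b)%O = (c <= b)%O.
Proof.
apply/idP/idP; first exact: (osuccP b).2.
by move=> /le_lt_trans; apply; exact: osucc_gt.
Qed.

Lemma osucc_le (b c : omega1) : (osucc b <= c)%O = (b < c)%O.
Proof. by rewrite leNgt ltoS -ltNge. Qed.

Lemma omega1_case (b : omega1) :
  [\/ b = ozero, exists c, b = osucc c | olimit b].
Proof.
have [->|b0] := pselect (b = ozero); first by constructor 1.
have [[c /osucc_ofE bc]|/forallNP nb] := pselect (exists c, osucc_of b c).
  by constructor 2; exists c.
by constructor 3.
Qed.

Lemma ozero_lt (b : omega1) : b <> ozero -> (ozero < b)%O.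
Proof. by move=> b0; rewrite lt_neqAle ozero_le andbT eq_sym; apply/eqP. Qed.

Lemma olimit_gt0 (b : omega1) : olimit b -> (ozero < b)%O.
Proof. by move=> [/ozero_lt]. Qed.

Lemma olimit_osucc (b c : omega1) : olimit b -> (c < b)%O -> (osucc c < b)%O.
Proof.
move=> [_ bS] cb; rewrite lt_neqAle osucc_le cb andbT.
by apply/eqP => /esym/osucc_ofE; exact: bS.
Qed.

Lemma lt_osup (A : set omega1) (x : omega1) : countable A ->
  (x < osup A)%O -> exists2 c, A c & (x < c)%O.
Proof.
move=> /osupP[_ lubA] xA; apply: contrapT => nA.
move: xA; rewrite ltNge => /negP; apply; apply: lubA => c Ac.
by rewrite leNgt; apply/negP => xc; apply: nA; exists c.
Qed.

Lemma le_osup (A : set omega1) (c : omega1) : countable A -> A c ->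
  (c <= osup A)%O.
Proof. by move=> /osupP[ubA _]; exact: ubA. Qed.

Lemma countable_olt (b : omega1) : countable [set c | (c < b)%O].
Proof.
apply: sub_countable (omega1_countable_segment b).
by apply: subset_card_le => c /ltW.
Qed.

Lemma countable_image_olt (f : omega1 -> omega1) (b : omega1) :
  countable (f @` [set c | (c < b)%O]).
Proof. exact: sub_countable (card_image_le _ _) (countable_olt b). Qed.

(** Addition, multiplication and exponentiation are all normal functions of
their second argument. *)
Section normal_functions.
Variable f : omega1 -> omega1.
Hypothesis fS : forall b, (f b < f (osucc b))%O.
Hypothesis flim : forall b, olimit b -> f b = osup (f @` [set c | (c < b)%O]).

Lemma normal_lt (b c : omega1) : (b < c)%O -> (f b < f c)%O.
Proof.
elim/omega1_ind: c => c IH bc; case: (omega1_case c) => [c0|[d cd]|lc].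
- by move: bc; rewrite c0 ltNge ozero_le.
- move: bc; rewrite cd ltoS le_eqVlt => /predU1P[->|bd]; first exact: fS.
  by apply: lt_trans (IH _ _ bd) (fS d); rewrite cd osucc_gt.
- apply: lt_le_trans (fS b) _; rewrite (flim lc).
  by apply: le_osup (countable_image_olt _ _) _; exists (osucc b) => //;
    exact: olimit_osucc.
Qed.

Lemma normal_ge (b : omega1) : (b <= f b)%O.
Proof.
elim/omega1_ind: b => b IH; rewrite leNgt; apply/negP => fb.
by have := IH _ fb; rewrite leNgt normal_lt.
Qed.

Lemma normal_lt_lim (b x : omega1) : olimit b -> (x < f b)%O ->
  exists2 c, (c < b)%O & (x < f c)%O.
Proof.
move=> lb; rewrite (flim lb) => /(lt_osup (countable_image_olt _ _)).
by move=> [_ [c cb <-] xc]; exists c.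
Qed.

End normal_functions.

Lemma oaddS (a b : omega1) : oadd a (osucc b) = osucc (oadd a b).
Proof. exact: orecS. Qed.

Lemma oadd_lim (a b : omega1) : olimit b ->
  oadd a b = osup (oadd a @` [set c | (c < b)%O]).
Proof. exact: orec_limit. Qed.

Lemma oadd_normal (a b : omega1) : (oadd a b < oadd a (osucc b))%O.
Proof. by rewrite oaddS osucc_gt. Qed.

Lemma omul0 (a : omega1) : omul a ozero = ozero.
Proof. exact: orec0. Qed.

Lemma omulS (a b : omega1) : omul a (osucc b) = oadd (omul a b) a.
Proof. exact: orecS. Qed.

Lemma omul_lim (a b : omega1) : olimit b ->
  omul a b = osup (omul a @` [set c | (c < b)%O]).
Proof. exact: orec_limit. Qed.

Lemma omul_normal (a : omega1) : (ozero < a)%O ->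
  forall b, (omul a b < omul a (osucc b))%O.
Proof.
move=> a0 b; rewrite omulS -{1}(_ : oadd (omul a b) ozero = omul a b).
  exact: normal_lt (@oadd_normal _) (@oadd_lim _) _ _ a0.
exact: orec0.
Qed.

Lemma oexpS (a b : omega1) : oexp a (osucc b) = omul (oexp a b) a.
Proof. exact: orecS. Qed.

Lemma oexp_lim (a b : omega1) : olimit b ->
  oexp a b = osup (oexp a @` [set c | (c < b)%O]).
Proof. exact: orec_limit. Qed.

Lemma olimit_oomega : olimit oomega.
Proof.
have cr : countable (range (fun n => iter n osucc ozero)).
  exact: sub_countable (card_image_le _ _) (countableP _).
split=> [w0|b /osucc_ofE wb].
  have : (osucc ozero <= oomega)%O by apply: le_osup => //; exists 1%N.
  by rewrite w0 osucc_le ltxx.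
have : (b < oomega)%O by rewrite wb osucc_gt.
move=> /(lt_osup cr)[_ [n _ <-]] bn.
have : (iter n.+1 osucc ozero <= oomega)%O by apply: le_osup => //; exists n.+1.
by rewrite wb [iter _ _ _]/= osucc_le ltoS leNgt bn.
Qed.

Lemma oexp_gt0 (b : omega1) : (ozero < oexp oomega b)%O.
Proof.
have e0 : oexp oomega ozero = osucc ozero by exact: orec0.
elim/omega1_ind: b => b IH; case: (omega1_case b) => [->|[c bc]|lb].
- by rewrite e0 osucc_gt.
- rewrite bc oexpS -{1}(omul0 (oexp oomega c)).
  apply: normal_lt (omul_normal _) (@omul_lim _) _ _ _.
    by apply: IH; rewrite bc osucc_gt.
  exact: olimit_gt0 olimit_oomega.
- rewrite (oexp_lim _ lb) -osucc_le -e0.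
  by apply: le_osup (countable_image_olt _ _) _; exists ozero => //;
    exact: olimit_gt0.
Qed.

Lemma oexp_normal (b : omega1) :
  (oexp oomega b < oexp oomega (osucc b))%O.
Proof.
have e0 := oexp_gt0 b.
apply: (@le_lt_trans _ _ (omul (oexp oomega b) (osucc ozero))).
  by rewrite omulS omul0; apply: normal_ge (@oadd_normal _) (@oadd_lim _) _.
rewrite oexpS; apply: normal_lt (omul_normal e0) (@omul_lim _) _ _ _.
exact: olimit_osucc olimit_oomega (olimit_gt0 olimit_oomega).
Qed.

(** * Cantor-Bendixson rank *)

(** The point k is in the b-th Cantor-Bendixson derivative, or is 0: the
condition is vacuous at ozero, which is isolated, so the lemmas below
assume a positive point where it matters. *)
Inductive cb_rank (b k : omega1) : Prop := CbRank of
  forall d x : omega1, (d < b)%O -> (x < k)%O ->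
    exists y, [/\ (x < y)%O, (y < k)%O & cb_rank d y].

Lemma cb_rank_le (b c k : omega1) : (c <= b)%O -> cb_rank b k -> cb_rank c k.
Proof.
move=> cb [h]; constructor => d x dc; apply: h.
exact: lt_le_trans dc cb.
Qed.

Lemma cb_rank_closed (b k : omega1) :
  (forall x, (x < k)%O -> exists y, [/\ (x < y)%O, (y <= k)%O & cb_rank b y]) ->
  cb_rank b k.
Proof.
move=> h; constructor => d x db /h[y [xy yk [hy]]].
have [z [xz zy dz]] := hy _ _ db xy.
by exists z; split=> //; exact: lt_le_trans zy yk.
Qed.

Lemma cb_rank_olimit (b k : omega1) :
  (ozero < b)%O -> (ozero < k)%O -> cb_rank b k -> olimit k.
Proof.
move=> b0 k0 [h]; split=> [kE|c [ck cmax]]; first by rewrite kE ltxx in k0.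
have [y [cy yk _]] := h _ _ b0 ck.
by have := cmax _ yk; rewrite leNgt cy.
Qed.

(** The map y |-> a + y is a homeomorphism onto a final segment, so it
preserves derivatives. *)
Lemma cb_rank_oadd (a b k : omega1) :
  (ozero < k)%O -> cb_rank b k -> cb_rank b (oadd a k).
Proof.
elim/omega1_ind: b k => b IH k k0 bk; constructor => d x db xk.
have lk : olimit k.
  by apply: cb_rank_olimit (bk) => //; exact: le_lt_trans (ozero_le d) db.
have [c ck xc] := normal_lt_lim (@oadd_lim a) lk xk.
case: bk => /(_ _ _ db ck)[y [cy yk dy]].
have lt_add := normal_lt (@oadd_normal a) (@oadd_lim a).
exists (oadd a y); split; [exact: lt_trans xc (lt_add _ _ cy)|exact: lt_add|].
by apply: IH => //; exact: le_lt_trans (ozero_le c) cy.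
Qed.

(** Every multiple k * (d + 1) = k * d + k has the rank of k by translation,
and derivatives are closed under suprema. *)
Lemma cb_rank_omul (b k c : omega1) : (ozero < k)%O -> cb_rank b k ->
  (ozero < c)%O -> cb_rank b (omul k c).
Proof.
move=> k0 bk; elim/omega1_ind: c => c IH c0.
case: (omega1_case c) => [cE|[d ->]|lc]; first by rewrite cE ltxx in c0.
  by rewrite omulS; exact: cb_rank_oadd.
apply: cb_rank_closed => x /(normal_lt_lim (@omul_lim k) lc)[d dc xd].
have lt_mul := normal_lt (omul_normal k0) (@omul_lim k).
have Sdc := olimit_osucc lc dc.
exists (omul k (osucc d)); split.
- exact: lt_trans xd (lt_mul _ _ (osucc_gt d)).
- exact/ltW/lt_mul.
- by apply: IH => //; exact: le_lt_trans (ozero_le d) (osucc_gt d).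
Qed.

(** At a successor, w^c * w is the limit of the multiples of w^c, all of rank
c; at a limit, w^b is the limit of the w^(e + 1) with e < b. *)
Lemma cb_rank_oexp (b : omega1) : cb_rank b (oexp oomega b).
Proof.
have lt_exp := normal_lt oexp_normal (@oexp_lim oomega).
elim/omega1_ind: b => b IH; constructor => d x db xb.
case: (omega1_case b) => [b0|[c bc]|lb].
- by move: db; rewrite b0 ltNge ozero_le.
- have dc : (d <= c)%O by rewrite -ltoS -bc.
  have cc : cb_rank c (oexp oomega c) by apply: IH; rewrite bc osucc_gt.
  have c0 := oexp_gt0 c.
  move: xb; rewrite bc oexpS => /(normal_lt_lim (@omul_lim _) olimit_oomega)[e ew xe].
  have lt_mul := normal_lt (omul_normal c0) (@omul_lim _).
  exists (omul (oexp oomega c) (osucc e)); split.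
  + exact: lt_trans xe (lt_mul _ _ (osucc_gt e)).
  + exact/lt_mul/(olimit_osucc olimit_oomega).
  + apply: cb_rank_le dc _; apply: cb_rank_omul => //.
    exact: le_lt_trans (ozero_le e) (osucc_gt e).
- have [e eb xe] := normal_lt_lim (@oexp_lim oomega) lb xb.
  have mb : (Order.max d e < b)%O by rewrite gt_max db.
  exists (oexp oomega (osucc (Order.max d e))); split.
  + apply: lt_trans xe (lt_exp _ _ _).
    by rewrite ltoS le_max lexx orbT.
  + exact/lt_exp/olimit_osucc.
  + apply: cb_rank_le (IH _ (olimit_osucc lb mb)).
    by apply: ltW; rewrite ltoS le_max lexx.
Qed.

(** * The hereditary families *)

(** With an enumeration e of the ordinals below b, the maximum of
e 0, ..., e n does the job; this treats successors and limits at once. *)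
Lemma cofinal_seq_exists (b : omega1) : (ozero < b)%O ->
  exists s : nat -> omega1, (forall n, (s n < b)%O) /\
    forall d, (d < b)%O -> exists N, forall n, (N <= n)%N -> (d <= s n)%O.
Proof.
move=> b0; have [f finj] : exists f : omega1 -> nat,
    {in [set d : omega1 | (d < b)%O] &, injective f}.
  exact/countable_injP/countable_olt.
pose e n : omega1 := get [set d : omega1 | (d < b)%O && (f d == n)].
pose s n := \big[Order.max/ozero]_(i < n.+1)
  (if (e i < b)%O then e i else ozero).
exists s; split=> [n|d db].
  by apply: bigmax_lt => // i _; case: ifPn.
exists (f d) => n fdn.
have eE : e (f d) = d.
  have : (e (f d) < b)%O && (f (e (f d)) == f d).
    by apply: (@getPex _ [set x : omega1 | (x < b)%O && (f x == f d)]); exists d;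
      rewrite /= db eqxx.
  by move=> /andP[eb /eqP]; apply: finj; rewrite inE.
by apply: le_trans (le_bigmax _ _ (inord (f d))); rewrite inordK// eE db.
Qed.

Definition cofinal_seq (b : omega1) : nat -> omega1 :=
  get [set s : nat -> omega1 | (forall n, (s n < b)%O) /\
    forall d, (d < b)%O -> exists N, forall n, (N <= n)%N -> (d <= s n)%O].

Lemma cofinal_seqP (b : omega1) : (ozero < b)%O ->
  (forall n, (cofinal_seq b n < b)%O) /\
  forall d, (d < b)%O -> exists N, forall n, (N <= n)%N -> (d <= cofinal_seq b n)%O.
Proof. by move=> /cofinal_seq_exists/getPex. Qed.

Definition above (n : nat) : set nat := [set i | (n < i)%N].

(** Keeping only the integers above n makes the sets built from the n-th
family converge to the empty set, hence the family compact. The sets without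
n are there so that removing n does not lead out of the family: the families
of cofinal_seq b n and cofinal_seq b m need not be comparable. *)
Inductive ranked_family (b : omega1) : set nat -> Prop :=
| ranked_empty : ranked_family b set0
| ranked_tail n S : (ozero < b)%O -> ranked_family (cofinal_seq b n) S ->
    ranked_family b (S `&` above n)
| ranked_cons n S : (ozero < b)%O -> ranked_family (cofinal_seq b n) S ->
    ranked_family b (n |` (S `&` above n)).

Lemma ranked_family_hereditary (b : omega1) (S G : set nat) :
  ranked_family b S -> ranked_family b (S `&` G).
Proof.
elim=> {b S} [b|b n S b0 _ IH|b n S b0 _ IH].
- by rewrite set0I; exact: ranked_empty.
- by rewrite setIAC; exact: ranked_tail.
- rewrite setIUl setIAC; have [nG|nG] := pselect (G n).
    by rewrite set1I mem_set//; exact: ranked_cons.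
  by rewrite set1I memNset// set0U; exact: ranked_tail.
Qed.

Lemma ranked_family_finite (b : omega1) (S : set nat) : ranked_family b S -> finite_set S.
Proof.
elim=> {b S} [b|b n S _ _ fS|b n S _ _ fS]; first exact: finite_set0.
  exact: finite_setIl.
by rewrite finite_setU; split; [exact: finite_set1|exact: finite_setIl].
Qed.

Lemma ranked_family1 (b : omega1) (n : nat) : (ozero < b)%O -> ranked_family b [set n].
Proof.
move=> b0; have -> : [set n] = n |` (set0 `&` above n) by rewrite set0I setU0.
by apply: ranked_cons b0 _; exact: ranked_empty.
Qed.

(** * Realising the families on intervals of ordinals *)

(** The condition for a positive k to be in the b-th oscillation set of
the indicators of the sets {z | F z n}, when each F z is finite: the n-th
indicator then exceeds all those of large index at any z with F z n. *)
Inductive branch_rank (F : omega1 -> set nat) (b k : omega1) : Prop := BranchRank of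
  forall d x : omega1, (d < b)%O -> (x < k)%O ->
    exists N, forall n, (N <= n)%N ->
      exists z, [/\ (x < z)%O, (z <= k)%O, F z n & branch_rank F d z].

Lemma branch_rank_le (F : omega1 -> set nat) (b c k : omega1) :
  (c <= b)%O -> branch_rank F b k -> branch_rank F c k.
Proof.
move=> cb [h]; constructor => d x dc; apply: h.
exact: lt_le_trans dc cb.
Qed.

(** The rank is determined by F near the point and by arbitrarily large
integers; this is what allows the values of F to be changed by {n} and
truncated above n. *)
Lemma branch_rank_transfer (F G : omega1 -> set nat) (m : nat) (c e b k : omega1) :
  (forall z n, (c < z)%O -> (z <= e)%O -> (m <= n)%N -> F z n -> G z n) ->
  (c < k)%O -> (k <= e)%O -> branch_rank F b k -> branch_rank G b k.
Proof.
move=> FG; elim/omega1_ind: b k => b IH k ck ke [h]; constructor => d x db xk.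
have [|N hN] := h d (Order.max c x) db; first by rewrite gt_max ck.
exists (maxn N m) => n; rewrite geq_max => /andP[/hN[z [+ zk Fz dz]] mn].
rewrite gt_max => /andP[cz xz]; have ze := le_trans zk ke.
by exists z; split=> //; [exact: FG|exact: IH].
Qed.

(** Continuity is expressed by left neighbourhoods, since each initial segment
[0, z] is open. The last clause asks for some point of the interval and not
for k itself, so that the points c_p of the construction need only have a
supremum at most k. *)
Record represents (b a k : omega1) (F : omega1 -> set nat) : Prop := {
  rep_cont : forall z n, (ozero < z)%O -> exists2 y, (y < z)%O &
    forall t, (y < t)%O -> (t <= z)%O -> (F t n <-> F z n);
  rep_ranked_family : forall z, ranked_family b (F z);
  rep_onto : forall S, ranked_family b S ->
    exists z, [/\ (a < z)%O, (z <= k)%O & F z = S];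
  rep_rank : exists z, [/\ (a < z)%O, (z <= k)%O, F z = set0 & branch_rank F b z] }.

Lemma represents0 (a k : omega1) :
  (a < k)%O -> represents ozero a k (fun=> set0).
Proof.
move=> ak; split=> // [z n z0|z|S|]; first by exists ozero.
- exact: ranked_empty.
- by case=> [|n T|n T]; rewrite ?ltxx//; exists k.
- exists k; split=> //; constructor => d x.
  by rewrite ltNge ozero_le.
Qed.

(** The inductive step: families of lower rank on consecutive intervals
(c p, c p.+1] are assembled into one. Intervals 2n and 2n.+1 both carry the
n-th family, the first with n added to every set. *)
Section glue.
Variables (b a k : omega1) (c : nat -> omega1) (F : nat -> omega1 -> set nat).
Hypothesis b0 : (ozero < b)%O.
Hypothesis c0 : c 0%N = a.
Hypothesis cS : forall p, (c p < c p.+1)%O.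
Hypothesis ck : forall p, (c p < k)%O.
Hypothesis repF : forall p, represents (cofinal_seq b p./2) (c p) (c p.+1) (F p).

Let top := osup (range c).

Let G (z : omega1) : set nat := [set i | exists p,
  [/\ (c p < z)%O, (z <= c p.+1)%O &
      ~~ odd p /\ i = p./2 \/ F p z i /\ above p./2 i]].

Let cc : countable (range c).
Proof. exact: sub_countable (card_image_le _ _) (countableP _). Qed.

Let c_homo (p q : nat) : (p <= q)%N -> (c p <= c q)%O.
Proof. by apply: (homo_leq le_refl le_trans) => i; exact: ltW. Qed.

Let c_top p : (c p < top)%O.
Proof. by apply: lt_le_trans (cS p) _; apply: le_osup => //; exists p.+1. Qed.

Let top_k : (top <= k)%O.
Proof. by apply: (osupP cc).2 => _ [p _ <-]; exact/ltW/ck. Qed.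

Let piece z : (a < z)%O -> (z < top)%O -> exists p, (c p < z <= c p.+1)%O.
Proof.
move=> az /(lt_osup cc)[_ [q _ <-] /ltW zq].
have ex : exists q, (z <= c q)%O by exists q.
case: (ex_minnP ex) => -[|p] zp pmin; first by rewrite c0 leNgt az in zp.
by exists p; rewrite zp andbT ltNge; apply/negP => /pmin; rewrite ltnn.
Qed.

Let piece_inj z p q : (c p < z)%O -> (z <= c p.+1)%O ->
  (c q < z)%O -> (z <= c q.+1)%O -> p = q.
Proof.
have aux i j : (c i < z)%O -> (z <= c j.+1)%O -> (i <= j)%N.
  move=> iz zj; rewrite leqNgt; apply/negP => /c_homo ji.
  by have := lt_le_trans iz (le_trans zj ji); rewrite ltxx.
by move=> pz zp qz zq; apply/eqP; rewrite eqn_leq !aux.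
Qed.

Let GE z p : (c p < z)%O -> (z <= c p.+1)%O ->
  G z = [set i | ~~ odd p /\ i = p./2] `|` (F p z `&` above p./2).
Proof.
move=> pz zp; apply/seteqP; split=> i; last by exists p.
by move=> [q [qz zq]]; rewrite (piece_inj pz zp qz zq).
Qed.

Let G_even z n : (c n.*2 < z)%O -> (z <= c n.*2.+1)%O ->
  G z = n |` (F n.*2 z `&` above n).
Proof.
move=> h1 h2; rewrite (GE h1 h2) odd_double doubleK; congr setU.
by apply/seteqP; split=> [i [_ ->]|i ->].
Qed.

Let G_odd z n : (c n.*2.+1 < z)%O -> (z <= c n.*2.+2)%O ->
  G z = F n.*2.+1 z `&` above n.
Proof.
move=> h1 h2; rewrite (GE h1 h2) /= odd_double uphalf_double /=.
by apply/seteqP; split=> [i [[]|]|i]//; right.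
Qed.

Let G_low z : (z <= a)%O -> G z = set0.
Proof.
move=> za; apply/seteqP; split=> // i [p [pz _ _]].
by have := c_homo (leq0n p); rewrite c0 leNgt (lt_le_trans pz za).
Qed.

Let G_high z : (top <= z)%O -> G z = set0.
Proof.
move=> tz; apply/seteqP; split=> // i [p [_ zp _]].
by have := c_top p.+1; rewrite ltNge (le_trans tz zp).
Qed.

Let G_cont z n : (ozero < z)%O -> exists2 y, (y < z)%O &
  forall t, (y < t)%O -> (t <= z)%O -> (G t n <-> G z n).
Proof.
move=> z0; have [za|az] := leP z a.
  by exists ozero => // t _ tz; rewrite !G_low// (le_trans tz).
have [tz|zt|<-] := ltgtP top z.
- exists top => // t tt _; rewrite !G_high//; exact: ltW.
- have [p /andP[pz zp]] := piece az zt.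
  have [y yz Fy] := rep_cont (repF p) n z0.
  exists (Order.max y (c p)); first by rewrite gt_max yz.
  move=> t; rewrite gt_max => /andP[yt pt] tz.
  rewrite (GE pz zp) (GE pt (le_trans tz zp)).
  by split=> -[|[/(Fy _ yt tz) ? ?]]; [left|right|left|right].
- exists (c n.+1.*2) => // t pt; rewrite le_eqVlt => /predU1P[->//|tt].
  rewrite (G_high (lexx _)); split=> // -[p [pz zp h]].
  have np : (n.+1.*2 <= p)%N.
    rewrite -ltnS ltnNge; apply/negP => /c_homo pn.
    by have := lt_le_trans pt (le_trans zp pn); rewrite ltxx.
  have {np} : (n < p./2)%N by rewrite -(doubleK n.+1) half_leq.
  by case: h => [[_ <-]|[_ /ltn_trans/[apply]]]; rewrite ltnn.
Qed.

Let G_rank : branch_rank G b top.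
Proof.
constructor => d x db /(lt_osup cc)[_ [P _ <-] xP].
have [N hN] := (cofinal_seqP b0).2 _ db.
exists (maxn P N) => n; rewrite geq_max => /andP[Pn /hN dn].
have [z []] := rep_rank (repF n.*2); rewrite doubleK => cz zc Fz dz.
exists z; split.
- apply: lt_trans xP (le_lt_trans _ cz); apply: c_homo.
  by rewrite (leq_trans Pn)// -addnn leq_addr.
- exact/ltW/(le_lt_trans zc).
- by rewrite (G_even cz zc); left.
- apply: branch_rank_le dn _.
  apply: (branch_rank_transfer (m := n.+1) _ cz zc) dz => t i ct tc ni Fi.
  by rewrite (G_even ct tc); right.
Qed.

(** The function G is empty outside (a, top), where top is the supremum of
the c p; its point of rank b is top. *)
Lemma represents_glue : exists G, represents b a k G.
Proof.
have at_ : (a < top)%O by rewrite -c0.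
have pieceS p z : (c p < z)%O -> (z <= c p.+1)%O -> (a < z)%O && (z <= k)%O.
  move=> pz zp; rewrite (le_trans zp (ltW (ck _))) andbT.
  by apply: le_lt_trans pz; rewrite -c0; exact: c_homo.
exists G; split.
- exact: G_cont.
- move=> z; have [za|az] := leP z a; first by rewrite G_low//; exact: ranked_empty.
  have [tz|zt] := leP top z; first by rewrite G_high//; exact: ranked_empty.
  have [p] := piece az zt; rewrite -(odd_double_half p).
  case: (odd p) => /andP[] pz zp.
    rewrite (G_odd pz zp); apply: ranked_tail b0 _.
    by have := rep_ranked_family (repF p./2.*2.+1) z; rewrite /= uphalf_double.
  rewrite (G_even pz zp); apply: ranked_cons b0 _.
  by have := rep_ranked_family (repF p./2.*2) z; rewrite doubleK.
- move=> _ [|n S _ fS|n S _ fS].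
  + by exists top; split=> //; exact: G_high.
  + have [z [pz zp Fz]] : exists z,
        [/\ (c n.*2.+1 < z)%O, (z <= c n.*2.+2)%O & F n.*2.+1 z = S].
      by apply: rep_onto (repF _) _ _; rewrite /= uphalf_double.
    have /andP[az zk] := pieceS _ _ pz zp.
    by exists z; split=> //; rewrite (G_odd pz zp) Fz.
  + have [z [pz zp Fz]] : exists z,
        [/\ (c n.*2 < z)%O, (z <= c n.*2.+1)%O & F n.*2 z = S].
      by apply: rep_onto (repF _) _ _; rewrite doubleK.
    have /andP[az zk] := pieceS _ _ pz zp.
    by exists z; split=> //; rewrite (G_even pz zp) Fz.
- by exists top; split=> //; exact: G_high.
Qed.

End glue.

Lemma representation (b a k : omega1) : (a < k)%O -> cb_rank b k ->
  exists F, represents b a k F.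
Proof.
elim/omega1_ind: b a k => b IH a k ak [bk].
case: (eqVneq b ozero) => [->|/eqP/ozero_lt b0].
  by exists (fun=> set0); exact: represents0.
pose next p (x : omega1) : omega1 :=
  get [set y : omega1 | [/\ (x < y)%O, (y < k)%O & cb_rank (cofinal_seq b p./2) y]].
have nextP p x : (x < k)%O ->
    [/\ (x < next p x)%O, (next p x < k)%O & cb_rank (cofinal_seq b p./2) (next p x)].
  move=> xk; apply: (@getPex _ [set y : omega1 |
    [/\ (x < y)%O, (y < k)%O & cb_rank (cofinal_seq b p./2) y]]).
  exact: bk ((cofinal_seqP b0).1 _) xk.
pose c := fix c p := if p is q.+1 then next q (c q) else a.
have ck p : (c p < k)%O by elim: p => //= p /(nextP p)[].
have rep p : exists F, represents (cofinal_seq b p./2) (c p) (c p.+1) F.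
  by have [cS _ cr] := nextP p _ (ck p); apply: IH; [exact: (cofinal_seqP b0).1| |].
have [F repF] := choice rep.
by apply: (@represents_glue b a k c F) => // p; have [] := nextP p _ (ck p).
Qed.

(** * Topology of the ordinal spaces *)

Section ospace_topology.
Variable a : omega1.
Implicit Types (k z : ospace a) (A U : set (ospace a)).

(** Left intervals are neighbourhoods because the immediate successor of k, if
it is in the space, gives an open ray that ends at k. *)
Lemma nbhs_ospace k U : U k ->
  ((ozero < val k)%O -> exists2 y, (y < val k)%O &
     forall z, (y < val z)%O -> (val z <= val k)%O -> U z) -> nbhs k U.
Proof.
move=> Uk lU.
have up : nbhs k [set z | (val z <= val k)%O].
  have [ka|] := ltP (val k) a; last first.
    by move=> ak; apply: filterS filterT => z _; apply: le_trans (valP z) ak.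
  have Ska : (osucc (val k) <= a)%O by rewrite osucc_le.
  have : nbhs k [set` `]-oo, (exist _ (osucc (val k)) Ska : ospace a)[].
    apply: open_nbhs_nbhs; split; first exact: lray_open.
    by rewrite /= in_itv/=; exact: osucc_gt.
  by apply: filterS => z; rewrite /= in_itv/= => zk; rewrite -ltoS; exact: zk.
have [k0|] := eqVneq (val k) ozero.
  apply: filterS up => z; rewrite /= k0 => z0.
  by rewrite (_ : z = k)//; apply/val_inj/le_anti; rewrite k0 z0 ozero_le.
move=> /eqP/ozero_lt/lU[y yk yU].
have ya : (y <= a)%O by exact: le_trans (ltW yk) (valP k).
have low : nbhs k [set` `](exist _ y ya : ospace a), +oo[].
  by apply: open_nbhs_nbhs; split; [exact: rray_open|rewrite /= in_itv/= andbT].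
apply: filterS (filterI up low) => z []; rewrite /= in_itv/= andbT => zk yz.
exact: yU.
Qed.

Lemma nbhs_ospace_left k U : nbhs k U -> (ozero < val k)%O ->
  exists2 y, (y < val k)%O &
    forall z, (y < val z)%O -> (val z <= val k)%O -> U z.
Proof.
rewrite itv_nbhsE => -[[l r] [oi ki] iU] k0.
have {ki} /andP[lk kr] : (l <= BLeft k)%O && (BRight k <= r)%O.
  by rewrite -itv_boundlr.
have inU (z : ospace a) : (val z <= val k)%O -> (l <= BLeft z)%O -> U z.
  move=> zk lz; apply: iU; rewrite /= itv_boundlr lz /=.
  by apply: le_trans kr; rewrite bnd_simp.
case: l oi lk inU {iU} => [bl l oi lk inU|[] oi lk inU]; last first.
- by [].
- by exists ozero => // z _ zk; apply: inU.
- move: lk; rewrite (itv_open_ends_lside oi) bnd_simp => lk.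
  exists (val l) => // z lz zk; apply: inU zk _.
  rewrite (itv_open_ends_lside oi) bnd_simp; exact: lz.
Qed.

(** Local constancy on the left is enough, as every [0, k] is open. *)
Lemma clopen_ospace A :
  (forall k, (ozero < val k)%O -> exists2 y, (y < val k)%O &
     forall z, (y < val z)%O -> (val z <= val k)%O -> (A z <-> A k)) ->
  clopen A.
Proof.
move=> lA; split.
- rewrite openE => k Ak; apply: nbhs_ospace => // /lA[y yk yA].
  by exists y => // z yz zk; apply/yA.
- rewrite -openC openE => k Ak; apply: nbhs_ospace => // /lA[y yk yA].
  by exists y => // z yz zk /(yA _ yz zk).
Qed.

Lemma clopen_initial k : clopen [set z : ospace a | (val z <= val k)%O].
Proof.
apply: clopen_ospace => z z0; have [zk|kz] := leP (val z) (val k).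
  exists ozero => // t _ tz; split=> // _; exact: le_trans tz zk.
exists (val k) => // t kt tz; split; last by rewrite /= leNgt kz.
by rewrite /= leNgt kt.
Qed.

End ospace_topology.

(** * Oscillation sets *)

Lemma finite_nat_bounded (S : set nat) : finite_set S ->
  exists M, forall i, S i -> (i < M)%N.
Proof.
move=> /finite_seqP[s ->]; exists (\max_(i <- s) i).+1 => i /= si.
by rewrite ltnS; apply: (@leq_bigmax_seq _ s xpredT id i).
Qed.

Section oscillation_rank.
Variables (R : realType) (a : omega1) (F : omega1 -> set nat).
Variable f : nat -> ospace a -> R.
Hypothesis Ffin : forall z, finite_set (F z).
Hypothesis fE : forall n, f n = \1_[set k | F (val k) n].

(** The point must be positive, since branch_rank is vacuous at ozero. *)
Lemma oscillation_branch_rank (eps : R) (b : omega1) (k : ospace a) : 0 < eps ->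
  (ozero < val k)%O -> branch_rank F b (val k) -> oscillation (1 - eps) f b k.
Proof.
move=> e0; elim/omega1_ind: b k => b IH k k0 bk.
case: (omega1_case b) => [->|[c bc]|lb]; first by rewrite oscillation0.
- rewrite bc oscillationS; have cb : (c < b)%O by rewrite bc osucc_gt.
  split; first exact: IH cb _ k0 (branch_rank_le (ltW cb) bk).
  move=> U /nbhs_ospace_left/(_ k0)[x xk xU].
  case: bk => /(_ _ _ cb xk)[N hN]; exists N => n /hN[z [xz zk Fzn cz]].
  have za : (z <= a)%O := le_trans zk (valP k).
  have [M FM] := finite_nat_bounded (Ffin z).
  pose y : ospace a := exist _ z za.
  exists M; left; exists y; split; last exact: xU.
  split; last by apply: IH => //; exact: le_lt_trans (ozero_le x) xz.
  move=> m /= Mm; rewrite /osc_pos /= !fE !indicE mem_set// memNset/=.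
    by rewrite subr0 ltrBlDr ltrDl.
  by move=> /FM; rewrite ltnNge Mm.
- rewrite (oscillation_limit _ _ lb) => c cb; apply: IH => //.
  exact: branch_rank_le (ltW cb) bk.
Qed.

End oscillation_rank.

(** * Indicator functions and weak convergence *)

Section indicators.
Variables (R : realType) (K : compactType).

(** Continuity holds for clopen sets only; the function is 0 otherwise, so that
no proof has to be carried along. *)
Definition indicator (A : set K) : Cspace R K := insubd 0 (\1_A : K -> R^o).

Lemma continuous_indicator (A : set K) :
  clopen A -> continuous (\1_A : K -> R^o).
Proof.
move=> [oA cA] k; apply/cvgrPdist_lt => e e0.
have [Ak|nAk] := pselect (A k).
  have : nbhs k A by apply: open_nbhs_nbhs.
  by apply: filterS => z Az; rewrite !indicE !mem_set// subrr normr0.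
have : nbhs k (~` A) by apply: open_nbhs_nbhs; split=> //; rewrite openC.
by apply: filterS => z nAz; rewrite !indicE !memNset// subrr normr0.
Qed.

Lemma indicatorE (A : set K) : clopen A -> (indicator A : K -> R) = \1_A.
Proof.
move=> cA; rewrite /Cspace_fun /indicator insubdK//.
by rewrite /in_mem /=; apply/asboolP; exact: continuous_indicator.
Qed.

Lemma CspaceP (f g : Cspace R K) : (forall k, f k = g k) -> f = g.
Proof. by move=> fg; apply: val_inj; apply/funext. Qed.

Lemma Cspace_addE (f g : Cspace R K) k : Cspace_fun (f + g) k = f k + g k.
Proof. by []. Qed.

Lemma Cspace_oppE (f : Cspace R K) k : Cspace_fun (- f) k = - f k.
Proof. by []. Qed.

Lemma Cspace_scaleE (c : R) (f : Cspace R K) k : Cspace_fun (c *: f) k = c * f k.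
Proof. by []. Qed.

Lemma Cspace_normE (f : Cspace R K) : `|f| = supnorm f.
Proof. by []. Qed.

Lemma indicator0 : indicator set0 = 0.
Proof.
by apply: CspaceP => k; rewrite (indicatorE clopen0) indicE in_set0.
Qed.

Lemma indicatorU (A B : set K) : clopen A -> clopen B -> A `&` B = set0 ->
  indicator (A `|` B) = indicator A + indicator B.
Proof.
move=> cA cB AB; apply: CspaceP => k; rewrite Cspace_addE !indicatorE//; last first.
  exact: clopenU.
rewrite !indicE in_setU; have : ~ ((k \in A) && (k \in B)).
  by move=> /andP[/set_mem Ak /set_mem Bk]; rewrite -[False]/(set0 k) -AB.
by case: (k \in A); case: (k \in B); rewrite //= ?addr0 ?add0r.
Qed.

End indicators.

Section weak_convergence.
Variables (R : realType) (a : omega1) (A : nat -> set (ospace a)).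
Hypothesis cA : forall n, clopen (A n).
Hypothesis A0 : forall k, exists N, forall n, (N <= n)%N -> ~ A n k.
Variable phi : {linear Cspace R (ospace a) -> R^o}.
Hypothesis cphi : continuous phi.

Let initial (k : ospace a) : set (ospace a) := [set z | (val z <= val k)%O].

Lemma functional_bound : exists C, forall f, `|f| <= 1 -> `|phi f| <= C.
Proof.
have /linear_bounded_continuous/linear_boundedP/pinfty_ex_gt0[C C0 hC] := cphi.
exists C => f f1; apply: le_trans (hC f) _.
by rewrite -[leRHS]mulr1 ler_wpM2l// ltW.
Qed.

(** Let h be an almost maximiser of phi among the functions of norm at most 1
that vanish beyond some g < k. The part of A n in [0, g] is handled by
induction. Since k is eventually outside the clopen set A n, the part T of
A n in (g, k] stays away from k, so h + 1_T and h - 1_T are competitors of h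
and phi (1_T) is small. *)
Lemma functional_initial (k : ospace a) (e : R) : 0 < e ->
  exists N, forall n, (N <= n)%N -> `|phi (indicator R (A n `&` initial k))| <= e.
Proof.
move: e; have [b] : exists b, b = val k by exists (val k).
elim/omega1_ind: b k => b IH k bk e e0.
have [N AN] := A0 k.
have [k0|/eqP/ozero_lt k0] := eqVneq (val k) ozero.
  exists N => n /AN nAk; rewrite (_ : _ `&` _ = set0); last first.
    apply/seteqP; split=> // z [Az]; rewrite /initial /= k0 => z0; apply: nAk.
    rewrite (_ : k = z)//; apply/val_inj/le_anti; rewrite k0 z0 ozero_le//.
  by rewrite indicator0 linear0 normr0 ltW.
have [C hC] := functional_bound.
(* The bound g is not fixed: competitors may vanish only closer to k. *)
pose E := [set phi h | h in [set h : Cspace R (ospace a) | `|h| <= 1 /\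
  exists2 g, (g < val k)%O & forall z, (g < val z)%O -> h z = 0]].
have supE : has_sup E.
  split; last by exists C => _ [h [h1 _] <-]; rewrite (le_trans (ler_norm _)) ?hC.
  exists (phi 0); exists 0 => //; split; first by rewrite normr0.
  by exists ozero.
have e2 : 0 < e / 2 by rewrite divr_gt0.
have [_ [h [h1 [g0 gk hg]] <-] Eh] := sup_adherent e2 supE.
pose g : ospace a := exist _ g0 (le_trans (ltW gk) (valP k)).
have [|N' hN'] := IH (val g) _ g erefl _ e2; first by rewrite bk.
exists (maxn N N') => n; rewrite geq_max => /andP[/AN nAk /hN' phig].
have [y yk yA] : exists2 y, (y < val k)%O &
    forall z : ospace a, (y < val z)%O -> (val z <= val k)%O -> ~ A n z.
  apply: nbhs_ospace_left k0; apply: open_nbhs_nbhs; split=> //.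
  by rewrite openC; have [] := cA n.
have cI k' : clopen (initial k') by exact: clopen_initial.
pose T := (A n `&` initial k) `&` ~` initial g.
have cT : clopen T by apply: clopenI; [exact: clopenI|exact: clopenC].
have -> : A n `&` initial k = (A n `&` initial g) `|` T.
  rewrite /T; apply/seteqP; split=> [z [Az zk]|z [[Az zg]|[[]]//]].
    by have [zg|zg] := pselect (initial g z); [left|right].
  by split=> //; exact/ltW/(le_lt_trans zg gk).
rewrite indicatorU//; last 2 first.
- exact: clopenI.
- by apply/seteqP; split=> // z [[_ zg] [_ /(_ zg)]].
have cTE := indicatorE R cT.
(* The supports of h and T are disjoint, so the norm stays at most 1. *)
have inE (s : R) : `|s| = 1 -> E (phi (h + s *: indicator R T)).
  move=> s1; exists (h + s *: indicator R T) => //; split; last first.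
    exists (Order.max g0 y); first by rewrite gt_max gk.
    move=> z; rewrite gt_max => /andP[gz yz].
    rewrite Cspace_addE Cspace_scaleE hg// cTE indicE memNset ?mulr0 ?addr0//.
    by move=> [[Az zk] _]; exact: yA yz zk Az.
  rewrite Cspace_normE; apply: supnorm_le => // z.
  rewrite Cspace_addE Cspace_scaleE cTE indicE.
  have [zg|gz] := leP (val z) g0.
    rewrite memNset; last by move=> [_]; apply.
    by rewrite mulr0 addr0 (le_trans _ h1)// Cspace_normE supnorm_ge.
  rewrite hg// add0r normrM s1 mul1r.
  by case: (_ \in _); rewrite ?normr1 ?normr0.
have leE s : `|s| = 1 -> s * phi (indicator R T) <= e / 2.
  move=> /inE/(ub_le_sup supE.2); rewrite linearD linearZ /= => le_sup.
  by rewrite -(lerD2l (phi h)) (le_trans le_sup)// -lerBlDr ltW.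
have phiT : `|phi (indicator R T)| <= e / 2.
  have := leE 1 (normr1 _); have := leE (-1); rewrite normrN1 => /(_ erefl).
  by rewrite mulN1r mul1r ler_norml lerNl => -> ->.
rewrite linearD (le_trans (ler_normD _ _))// [leRHS](splitr e) lerD//.
Qed.

End weak_convergence.

(** The previous lemma at the last point of the space. *)
Lemma weakly_null_indicators (R : realType) (a : omega1)
    (A : nat -> set (ospace a)) :
  (forall n, clopen (A n)) ->
  (forall k, exists N, forall n, (N <= n)%N -> ~ A n k) ->
  weakly_null (fun n => indicator R (A n)).
Proof.
move=> cA A0 phi cphi; apply/cvgrPdist_le => e e0.
pose top : ospace a := exist _ a (lexx a).
have [N hN] := functional_initial cA A0 cphi top e0.
exists N => // n /= /hN; rewrite sub0r normrN.
rewrite (_ : _ `&` _ = A n)//; apply/seteqP; split=> [z []//|z Az].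
by split=> //; exact: (valP z).
Qed.

(** * Bases of indicators of a hereditary family *)

Section hereditary_indicators.
Variables (R : realType) (K : compactType).
Variables (x : nat -> Cspace R K) (A : nat -> set K).
Hypothesis xE : forall n, (x n : K -> R) = \1_(A n).
Hypothesis hereditary : forall k (G : set nat),
  exists k', forall n, A n k' <-> A n k /\ G n.
Hypothesis singleton : forall n, exists k, forall m, A m k <-> m = n.

Lemma Cspace_sumE (I : Type) (r : seq I) (P : pred I) (f : I -> Cspace R K) k :
  Cspace_fun (\sum_(i <- r | P i) f i) k = \sum_(i <- r | P i) f i k.
Proof. by apply: (big_morph (fun f => Cspace_fun f k)). Qed.

Let x_in n k : x n k = (k \in A n)%:R.
Proof. by rewrite xE indicE. Qed.

Let x_eq n k k' : (A n k <-> A n k') -> x n k = x n k'.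
Proof.
move=> kk'; rewrite !x_in; congr (nat_of_bool _)%:R.
by apply/idP/idP => /set_mem/kk'/mem_set.
Qed.

Let x_restrict k k' (G : set nat) n : (forall n, A n k' <-> A n k /\ G n) ->
  x n k' = (n \in G)%:R * x n k.
Proof.
move=> h; have [nG|nG] := pselect (G n).
  by rewrite mem_set// mul1r; apply: x_eq; rewrite h; split=> [[]|].
by rewrite memNset// mul0r x_in memNset// => /h[].
Qed.

Let sumE (a : nat -> R) (N : nat) k :
  Cspace_fun (\sum_(n < N) a n *: x n) k = \sum_(n < N) a n * x n k.
Proof. by rewrite Cspace_sumE. Qed.

(** The restriction to G of a combination of the x n takes at k the value
that the full combination takes at the point k' given by heredity. *)
Lemma suppression_indicators : suppression_unconditional1 x.
Proof.
move=> a G afin; have [N aN] := finite_nat_bounded afin.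
have sumG (H : set nat) : \sum_(n \in H) a n *: x n =
    \sum_(n < N) (a n * (nat_of_ord n \in H)%:R) *: x n.
  rewrite fsbig_mkcond (@fsbigE _ _ _ _ _ (index_iota 0 N)) ?iota_uniq//.
    rewrite big_mkcond big_mkord; apply: eq_bigr => i _.
    rewrite in_setT patchE; case: (_ \in H); first by rewrite mulr1.
    by rewrite mulr0 scale0r.
  move=> i _; rewrite mem_index_iota/= -leqNgt patchE => Ni.
  case: (_ \in H) => //; have [->|ai] := eqVneq (a i) 0.
    by rewrite scale0r.
  by have := aN _ ai; rewrite ltnNge Ni.
rewrite Cspace_normE; apply: supnorm_le => // k.
have [k' hk'] := hereditary k G.
rewrite (_ : Cspace_fun _ k = Cspace_fun (\sum_(n \in [set: nat]) a n *: x n) k').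
  exact: supnorm_ge.
rewrite !sumG (sumE (fun n => a n * (n \in G)%:R)).
rewrite (sumE (fun n => a n * (n \in [set: nat])%:R)); apply: eq_bigr => n _.
by rewrite (x_restrict _ hk') in_setT mulr1 mulrA.
Qed.

(** Evaluation at pt n is the n-th coordinate functional. *)
Let pt n : K := sval (cid (singleton n)).

Let x_pt n m : x m (pt n) = (m == n)%:R.
Proof.
rewrite x_in /pt; case: cid => k kE /=; congr (nat_of_bool _)%:R.
by apply/idP/eqP => [/set_mem/kE//|/kE/mem_set].
Qed.

Let sum_pt (a : nat -> R) (N i : nat) :
  Cspace_fun (\sum_(n < N) a n *: x n) (pt i) = if (i < N)%N then a i else 0.
Proof.
rewrite sumE; case: ltnP => iN.
  rewrite (bigD1 (Ordinal iN))//= x_pt eqxx mulr1 big1 ?addr0// => n ni.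
  by rewrite x_pt (_ : _ == _ = false) ?mulr0//; apply/negbTE.
rewrite big1// => n _; rewrite x_pt (_ : _ == _ = false) ?mulr0//.
by apply/negbTE; rewrite neq_ltn (leq_trans (ltn_ord n)).
Qed.

Let x_truncate m N k k' : (forall n, A n k' <-> A n k /\ (n < N)%N) ->
  x m k' = \sum_(n < N) x m (pt n) * x n k.
Proof.
move=> kk'; rewrite (@x_restrict k k' [set n | (n < N)%N])//.
case: (ltnP m N) => mN.
  rewrite mem_set// (bigD1 (Ordinal mN))//= x_pt eqxx big1 ?addr0// => n nm.
  by rewrite x_pt eq_sym (_ : _ == _ = false) ?mul0r//; apply/negbTE.
rewrite memNset ?mul0r ?big1//= => [n _|]; last by rewrite ltnNge mN.
rewrite x_pt (_ : _ == _ = false) ?mul0r//.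
by apply/negbTE; rewrite neq_ltn (leq_trans (ltn_ord n)) ?orbT.
Qed.

Let closure_lin_span (y : Cspace R K) (e : R) : closure (lin_span x) y -> 0 < e ->
  exists (a : nat -> R) N, forall k,
    `|y k - Cspace_fun (\sum_(n < N) a n *: x n) k| <= e.
Proof.
move=> /(_ (ball y e)) cy e0; have [|_ [[a [N ->]]]] := cy.
  exact: nbhsx_ballx.
rewrite -ball_normE /= => ye; exists a, N => k.
apply: le_trans (ltW ye).
exact: (supnorm_ge (y - \sum_(n < N) a n *: x n) k).
Qed.

(** Both sides are continuous in y for the norm, the right one with constant
N; this is why the span is approached up to e / N.+1. *)
Let closure_truncation (y : Cspace R K) N k k' : closure (lin_span x) y ->
  (forall n, A n k' <-> A n k /\ (n < N)%N) ->
  y k' = \sum_(n < N) y (pt n) * x n k.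
Proof.
move=> cy kk'; apply/eqP; rewrite -subr_eq0 -normr_le0.
apply/ler_addgt0Pl => e e0; rewrite addr0.
have N0 : 0 < N.+1%:R :> R by rewrite ltr0n.
have [a [M yM]] := closure_lin_span cy (divr_gt0 e0 N0).
set w : Cspace R K := \sum_(n < M) _ in yM.
have wk' : w k' = \sum_(n < N) w (pt n) * x n k.
  rewrite sumE; under [RHS]eq_bigr do rewrite sumE mulr_suml.
  rewrite exchange_big /=; apply: eq_bigr => m _.
  by rewrite (x_truncate m kk') mulr_sumr; apply: eq_bigr => n _; rewrite mulrA.
rewrite -[y k'](subrK (w k')) {2}wk' -addrA -sumrB.
under eq_bigr do rewrite -mulrBl.
apply: le_trans (ler_normD _ _) _.
set d := e / _ in yM.
have -> : e = d + d *+ N.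
  by rewrite -mulrS -[RHS]mulr_natr divfK// lt0r_neq0.
rewrite lerD//; apply: le_trans (ler_norm_sum _ _ _) _.
apply: (@le_trans _ _ (\sum_(n < N) d)); last by rewrite sumr_const card_ord.
rewrite ler_sum// => n _; rewrite normrM distrC -[leRHS]mulr1 ler_pM//.
by rewrite x_in; case: (_ \in _); rewrite ?normr1 ?normr0.
Qed.

(** The coefficients must be the values at the points pt n. For convergence,
let w be a combination of x 0, ..., x (M - 1) close to y and let N >= M: the
N-th partial sum at k is y k' where k' is k truncated at N, and w takes the
same value at k and k'. *)
Lemma basic_indicators : basic_sequence x.
Proof.
move=> y cy; exists (fun n => Cspace_fun y (pt n)); split; last first.
  move=> a ay; apply/funext => i; apply/eqP; rewrite -subr_eq0 -normr_le0.
  apply/ler_addgt0Pl => e e0; rewrite addr0.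
  move/cvgrPdist_le : ay => /(_ _ e0)[N _ hN].
  have := hN (maxn N i.+1) (leq_maxl _ _); apply: le_trans.
  rewrite Cspace_normE; apply: le_trans (supnorm_ge _ (pt i)).
  rewrite Cspace_addE Cspace_oppE /series /= big_mkord sum_pt.
  by rewrite leq_maxr.
apply/cvgrPdist_le => e e0.
have e2 : 0 < e / 2 by rewrite divr_gt0.
have [a [M yM]] := closure_lin_span cy e2; exists M => // N /= MN.
rewrite Cspace_normE; apply: supnorm_le => [|k]; first exact: ltW.
have [k' kk'] := hereditary k [set n | (n < N)%N].
rewrite Cspace_addE Cspace_oppE /series /= big_mkord.
rewrite (sumE (fun n => Cspace_fun y (pt n))).
rewrite -(closure_truncation cy kk').
have := yM k; have := yM k'; set w : Cspace R K := \sum_(n < M) _.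
have -> : w k' = w k.
  rewrite !sumE; apply: eq_bigr => n _; rewrite (x_restrict _ kk') mem_set ?mul1r//.
  exact: leq_trans (ltn_ord n) MN.
move=> h1 h2; rewrite (_ : Cspace_fun y k - _ =
  (Cspace_fun y k - w k) - (Cspace_fun y k' - w k)); last first.
  by rewrite opprB addrA subrK.
by rewrite (le_trans (ler_normB _ _))// [leRHS](splitr e) lerD.
Qed.

End hereditary_indicators.

Theorem theorem4p1 (R : realType) (alpha : omega1) :
  let omega_alpha := oexp oomega alpha in
  let K := ospace (oexp oomega omega_alpha) in
  exists x : nat -> Cspace R K,
    [/\ weakly_null x,
        forall eps : R, 0 < eps -> 0 < 1 - eps ->
          oscillation (1 - eps) (fun n => x n : K -> R) omega_alpha !=set0,
        exists A : nat -> set K, forall n, (x n : K -> R) = \1_(A n),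
        basic_sequence x &
        suppression_unconditional1 x].
Proof.
move=> b K; have b0 : (ozero < b)%O := oexp_gt0 alpha.
have [F repF] := representation (oexp_gt0 b) (cb_rank_oexp b).
pose A n : set K := [set k | F (val k) n].
have cA n : clopen (A n).
  apply: clopen_ospace => k /(rep_cont repF n)[y yk yF].
  by exists y => // z; exact: yF.
have xE n : (indicator R (A n) : K -> R) = \1_(A n) by exact: indicatorE.
have onto S : ranked_family b S -> exists k : K, forall n, A n k <-> S n.
  move=> /(rep_onto repF)[z [_ zb Fz]].
  by exists (exist _ z zb) => n; rewrite /A /= Fz.
have her k (G : set nat) : exists k', forall n, A n k' <-> A n k /\ G n.
  exact/onto/ranked_family_hereditary/(rep_ranked_family repF).
have Ffin z : finite_set (F z) := ranked_family_finite (rep_ranked_family repF z).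
exists (fun n => indicator R (A n)); split.
- apply: weakly_null_indicators => // k.
  have [N FN] := finite_nat_bounded (Ffin (val k)).
  by exists N => n Nn /FN; rewrite ltnNge Nn.
- move=> e e0 _; have [z [z0 zb Fz rz]] := rep_rank repF.
  pose k : K := exist _ z zb.
  by exists k; exact: (@oscillation_branch_rank _ _ _ _ Ffin xE _ _ k e0 z0 rz).
- by exists A.
- apply: basic_indicators xE her _ => n.
  exact/onto/ranked_family1.
- exact: suppression_indicators xE her.
Qed.
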